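(* Let $A$ be a unital (not necessarily commutative, associative or finite-dimensional) $\mathbb{R}$-algebra which is simultaneously a Banach space such that multiplication and addition are continuous and such that $\|xy\|\le\|x\|\cdot\|y\|$ for all $x,y\in A$. Let $(x_k)_{k\ge1}$ be a sequence in $A$ such that $\sum_{k=1}^{+\infty}\|x_k\|<+\infty$. Then the sequence $$p_n=\prod_{k=1}^n(1+x_k)$$ is convergent.
   Context: In a not necessarily associative unital algebra, the finite product $\prod_{k=1}^n y_k$ is defined recursively by $\prod_{k=1}^0y_k=1$ and $\prod_{k=1}^{n}y_k=\left(\prod_{k=1}^{n-1}y_k\right)y_n$, i.e. $\prod_{k=1}^ny_k=(\cdots((y_1y_2)y_3)\cdots y_n)$. *)

(* Defs.v *)
From mathcomp Require Import all_boot all_algebra.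
From mathcomp Require Import all_classical all_reals all_analysis.

Set Implicit Arguments.
Unset Strict Implicit.
Unset Printing Implicit Defensive.

(* (((y_1 y_2) y_3) ...) y_n, indexed from 1: the value y 0 is never used.
   The big operators of bigop nest to the right, which is a different element
   when mul is not associative. *)
Fixpoint left_prod (A : Type) (mul : A -> A -> A) (one : A) (y : nat -> A)
    (n : nat) : A :=
  if n is m.+1 then mul (left_prod mul one y m) (y n) else one.

(* Main.v *)
Require Import Defs.
From mathcomp Require Import all_boot all_order all_algebra.
From mathcomp Require Import all_classical all_reals all_analysis.
Import Order.TTheory GRing.Theory Num.Theory.
Import numFieldNormedType.Exports.
Local Open Scope classical_set_scope.
Local Open Scope ring_scope.

(** Write p_n for the left-nested product of the 1 + x_k.  Since p_(n+1) is
    p_n (1 + x_(n+1)), distributivity and the unit law give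
      p_(n+1) - p_n = p_n x_(n+1);
    the new factor stands outermost, so no reassociation is needed.  The recursion also
    gives |p_(n+1)| <= |p_n| (1 + |x_(n+1)|) <= |p_n| exp |x_(n+1)|, so p is
    bounded by a constant C (lemma [norm_left_prod_le]).  The increments of p are
    therefore dominated by C |x_(n+1)|, hence absolutely summable, and in a
    complete space a sequence with absolutely summable increments converges
    (lemma [cvgn_telescope_normed]). *)

Lemma sum_le_fine_nneseries (R : realType) (u : nat -> R) (m n : nat) :
  (forall k, 0 <= u k) -> (\sum_(m <= k <oo) (u k)%:E < +oo)%E ->
  \sum_(m <= k < n) u k <= fine (\sum_(m <= k <oo) (u k)%:E)%E.
Proof.
move=> u0 uoo; have uE0 k : (0 <= (u k)%:E)%E by rewrite lee_fin.
rewrite -lee_fin fineK; last by rewrite ge0_fin_numE// nneseries_ge0.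
by rewrite -sumEFin; apply: nneseries_lim_ge.
Qed.

Lemma cvgn_telescope_normed (R : realType) (V : completeNormedModType R)
    (p : nat -> V) :
  cvgn [normed series (telescope p)] -> cvgn p.
Proof.
move=> /normed_cvg cvg_incr.
rewrite (_ : p = (fun n => p 0%N + series (telescope p) n)); last first.
  by apply/funext => n; exact: eq_sum_telescope.
exact: is_cvgD (is_cvg_cst _) cvg_incr.
Qed.

Lemma left_prod1DS (R : realType) (A : normedModType R)
    (mul : {bilinear A -> A -> A}) (one : A) (x : nat -> A) (n : nat) :
  right_id one mul ->
  let p := left_prod mul one (fun k => one + x k) in
  p n.+1 = p n + mul (p n) (x n.+1).
Proof. by move=> mulx1 /=; rewrite linearDr mulx1. Qed.

(** The factor |one| is kept because the norm of the unit is only known to be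
    at least 1, or 0 if A is trivial. *)
Lemma norm_left_prod_le (R : realType) (A : normedModType R)
    (mul : {bilinear A -> A -> A}) (one : A) (x : nat -> A) (n : nat) :
  right_id one mul -> (forall x y : A, `|mul x y| <= `|x| * `|y|) ->
  `|left_prod mul one (fun k => one + x k) n|
    <= `|one| * expR (\sum_(1 <= k < n.+1) `|x k|).
Proof.
move=> mulx1 normM; elim: n => [|n IHn].
  by rewrite big_geq// expR0 mulr1.
rewrite left_prod1DS// big_nat_recr//= expRD mulrA.
set p := left_prod _ _ _ n in IHn *.
apply: (@le_trans _ _ (`|p| * (1 + `|x n.+1|))).
  by rewrite mulrDr mulr1 (le_trans (ler_normD _ _))// lerD2l.
by rewrite ler_pM// ?addr_ge0// expR_ge1Dx.
Qed.

Theorem proposition6p3 (R : realType) (A : completeNormedModType R)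
    (mul : {bilinear A -> A -> A}) (one : A)
    (mul1x : left_id one mul) (mulx1 : right_id one mul)
    (mul_continuous : continuous (fun z : A * A => mul z.1 z.2))
    (normM : forall x y : A, `|mul x y| <= `|x| * `|y|)
    (x : nat -> A)
    (sum_norm_x : (\sum_(1 <= k <oo) `|x k|%:E < +oo)%E) :
  cvg (left_prod mul one (fun k => one + x k) n @[n --> \oo]).
Proof.
set p := left_prod mul one _.
set S := fine (\sum_(1 <= k <oo) `|x k|%:E)%E.
have sum_le n : \sum_(1 <= k < n) `|x k| <= S.
  exact: (@sum_le_fine_nneseries _ (fun k => `|x k|)).
pose C := `|one| * expR S.
have C0 : 0 <= C by rewrite mulr_ge0// expR_ge0.
have p_le n : `|p n| <= C.
  apply: le_trans (norm_left_prod_le _ _ _ _ _ _ mulx1 normM) _.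
  by rewrite ler_wpM2l// ler_expR.
have pS n : p n.+1 = p n + mul (p n) (x n.+1) by exact: left_prod1DS.
have incr_le n : `|telescope p n| <= C * `|x n.+1|.
  have -> : telescope p n = mul (p n) (x n.+1).
    by rewrite -[telescope p n]/(p n.+1 - p n) pS addrAC subrr add0r.
  by apply: le_trans (normM _ _) _; rewrite ler_wpM2r.
apply: cvgn_telescope_normed; apply: nondecreasing_is_cvgn.
  by apply/nondecreasing_seqP => n; rewrite /= seriesSr lerDl.
exists (C * S) => _ [n _ <-].
rewrite /= /series/= (le_trans (ler_sum _ (fun i _ => incr_le i)))//.
by rewrite -mulr_sumr ler_wpM2l// -(big_add1 _ _ 0%N n.+1 xpredT (fun k => `|x k|)).
Qed.
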